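(* Let $b, t, n$ be positive integers with $t \ge b$. Then the set $\mathcal{H}_{b,t}(n)$ of hyper $(b,t)$-ary partitions of $n$, partially ordered by refinement, is a distributive lattice.
   Context: A partition of a positive integer $n$ is a finite multiset $\lambda=\{\lambda_1\ge\cdots\ge\lambda_k\}$ of positive integers (its parts) with $\sum_i\lambda_i=n$. For positive integers $b,t$ with $t\ge b$, a hyper $(b,t)$-ary partition of $n$ is a partition of $n$ all of whose parts are powers $b^j$ of $b$ ($j\ge 0$, so $b^0=1$ is allowed), each part size occurring with multiplicity at most $t$. $\mathcal{H}_{b,t}(n)$ denotes the set of all hyper $(b,t)$-ary partitions of $n$. Refinement order: for partitions $\lambda,\mu$ of $n$, $\mu\le\lambda$ if the parts of $\mu$ can be obtained from $\lambda$ by combining parts, i.e. the multiset of parts of $\lambda$ can be divided into disjoint nonempty groups whose sums, taken as a multiset, are exactly the parts of $\mu$. $\mathcal{H}_{b,t}(n)$ carries the restriction of this order. A poset is a lattice if every pair of elements $x,y$ has a least upper bound $x\lor y$ and a greatest lower bound $x\land y$. A lattice is distributive if $x\lor(y\land z)=(x\lor y)\land(x\lor z)$ and $x\land(y\lor z)=(x\land y)\lor(x\land z)$ for all $x,y,z$. *)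

(* Defs.v *)
From HB Require Import structures.
From mathcomp Require Import all_boot all_order.

Set Implicit Arguments.
Unset Strict Implicit.
Unset Printing Implicit Defensive.

(* A multiset of parts is represented by its unique weakly decreasing
   enumeration, so that equality of partitions is equality of sequences. *)
Definition is_partition (n : nat) (s : seq nat) : bool :=
  [&& sorted geq s, 0 \notin s & sumn s == n].

(* For b > 0 the bound j < x on the exponent loses nothing: j < b ^ j if
   b > 1, and 1 = b ^ 0; see [is_powerP]. *)
Definition is_power (b x : nat) : bool := [exists j : 'I_x, x == b ^ j].

Lemma is_powerP (b x : nat) :
  0 < b -> reflect (exists j, x = b ^ j) (is_power b x).
Proof.
move=> b_gt0; apply: (iffP existsP) => [[j /eqP xE]|[j xE]].
  by exists j.
case: (ltnP 1 b) => [b_gt1|b_le1].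
  have lt_jx : j < x by rewrite xE ltn_expl.
  by exists (Ordinal lt_jx); rewrite {1}xE.
have b1 : b = 1 by apply/eqP; rewrite eqn_leq b_le1.
have x_gt0 : 0 < x by rewrite xE b1 exp1n.
by exists (Ordinal x_gt0); rewrite {1}xE b1 !exp1n.
Qed.

Definition is_hyper_partition (b t n : nat) (s : seq nat) : bool :=
  [&& is_partition n s,
      all (is_power b) s
    & all (fun x => count_mem x s <= t) s].

Definition hyper_partition (b t n : nat) : Type :=
  {s : seq nat | is_hyper_partition b t n s}.

(* [refines_le mu la] is mu <= la: the groups in gs divide up the parts of la,
   and their sums are the parts of mu. *)
Definition refines_le (mu la : seq nat) : Prop :=
  exists gs : seq (seq nat),
    [/\ [::] \notin gs,
        perm_eq (flatten gs) la
      & perm_eq [seq sumn g | g <- gs] mu].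

Definition hyper_le (b t n : nat) (mu la : hyper_partition b t n) : Prop :=
  refines_le (val mu) (val la).

(* The relation le on T is the order of some distributive lattice structure
   on T; in particular it is a partial order. *)
Definition is_distr_lattice (T : Type) (le : T -> T -> Prop) : Prop :=
  exists (d : Order.disp_t) (L : Order.DistrLattice d T),
    forall x y : T, le x y <-> @Order.le d (Order.DistrLattice.Pack L) x y.

(* Main.v *)
(* For b > 1, sending a hyper partition to the function
   j |-> (sum of its parts smaller than b ^ j) turns refinement into the
   pointwise order. The image consists of the functions cut out by congruences
   mod b ^ j and by bounds on the difference of consecutive values; both
   survive pointwise min and max, so the poset is a sublattice of a power of
   the chain of natural numbers. For b = 1 there is at most one partition. *)
Require Import Defs.
From HB Require Import structures.
From mathcomp Require Import all_boot all_order.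
From mathcomp Require Import zify.

Set Implicit Arguments.
Unset Strict Implicit.
Unset Printing Implicit Defensive.

(** * Distributive lattices inside a power of the chain of natural numbers *)

(** All lattice identities and distributivity hold for [minn] and [maxn] at each index, and
    injectivity of [f] pulls them back to [T]. *)
Lemma distr_lattice_of_embedding (T : choiceType) (I : finType)
    (le : T -> T -> Prop) (f : T -> I -> nat) :
  (forall x y, le x y <-> forall i, f x i <= f y i) ->
  (forall x y, f x =1 f y -> x = y) ->
  (forall x y, exists z, forall i, f z i = minn (f x i) (f y i)) ->
  (forall x y, exists z, forall i, f z i = maxn (f x i) (f y i)) ->
  is_distr_lattice le.
Proof.
move=> leP f_inj f_min f_max.
(* As [I] is finite, the property of [z] can be stated as a boolean, so that [xchoose] turns mere
   existence into an operation. *)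
have minE x y : exists z, [forall i, f z i == minn (f x i) (f y i)].
  by have [z zE] := f_min x y; exists z; apply/forallP => i; rewrite zE.
have maxE x y : exists z, [forall i, f z i == maxn (f x i) (f y i)].
  by have [z zE] := f_max x y; exists z; apply/forallP => i; rewrite zE.
pose meet x y := xchoose (minE x y); pose join x y := xchoose (maxE x y).
have meetE x y i : f (meet x y) i = minn (f x i) (f y i).
  exact: (eqP (forallP (xchooseP (minE x y)) i)).
have joinE x y i : f (join x y) i = maxn (f x i) (f y i).
  exact: (eqP (forallP (xchooseP (maxE x y)) i)).
pose leb (x y : T) := [forall i, f x i <= f y i].
pose ltb (x y : T) := (y != x) && leb x y.
have leb_meet x y : leb x y = (meet x y == x).
  apply/forallP/eqP => [lexy|<- i]; last by rewrite meetE geq_minr.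
  by apply: f_inj => i; rewrite meetE; apply/minn_idPl.
have ltb_def x y : ltb x y = (y != x) && leb x y by [].
have meetC : commutative meet by move=> x y; apply: f_inj => i; rewrite !meetE minnC.
have joinC : commutative join by move=> x y; apply: f_inj => i; rewrite !joinE maxnC.
have meetA : associative meet by move=> x y z; apply: f_inj => i; rewrite !meetE minnA.
have joinA : associative join by move=> x y z; apply: f_inj => i; rewrite !joinE maxnA.
have joinKI y x : meet x (join x y) = x.
  by apply: f_inj => i; rewrite meetE joinE minnC maxnK.
have meetKU y x : join x (meet x y) = x.
  by apply: f_inj => i; rewrite joinE meetE maxnC minnK.
have meetUl : left_distributive meet join.
  by move=> x y z; apply: f_inj => i; rewrite !(meetE, joinE) minn_maxl.
have meetxx : idempotent_op meet by move=> x; apply: f_inj => i; rewrite meetE minnn.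
pose d := Order.Disp tt tt.
pose M := @Order.isMeetJoinDistrLattice.Axioms_ d T (Choice.class T) (Choice.class T)
  leb ltb meet join leb_meet ltb_def meetC joinC meetA joinA joinKI meetKU meetUl meetxx.
pose L : distrLatticeType d := HB.pack T M.
exists d, (Order.DistrLattice.class L) => x y.
by rewrite leP; split=> [lexy|/forallP]; first exact/forallP.
Qed.

(** * Sums of the parts below a threshold *)

Definition low (k : nat) (s : seq nat) : nat := \sum_(x <- s | x < k) x.

Lemma perm_low k s1 s2 : perm_eq s1 s2 -> low k s1 = low k s2.
Proof. exact: perm_big. Qed.

Lemma low_cat k s1 s2 : low k (s1 ++ s2) = low k s1 + low k s2.
Proof. by rewrite /low big_cat. Qed.

Lemma low_cons k x s : low k (x :: s) = (if x < k then x else 0) + low k s.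
Proof. by rewrite /low big_cons; case: ifP. Qed.

Lemma low_nil k : low k [::] = 0.
Proof. by rewrite /low big_nil. Qed.

Lemma low_le_sumn k s : low k s <= sumn s.
Proof. by elim: s => [|x s IHs]; rewrite (low_nil, low_cons) //=; case: ifP; lia. Qed.

Lemma low_all_lt k s : all (fun x => x < k) s -> low k s = sumn s.
Proof.
by elim: s => [|x s IHs] /=; rewrite (low_nil, low_cons) //= => /andP[-> /IHs <-].
Qed.

Lemma low_all_ge k s : all (leq k) s -> low k s = 0.
Proof.
elim: s => [|x s IHs] /=; rewrite (low_nil, low_cons) //=.
by rewrite leqNgt => /andP[/negbTE -> /IHs].
Qed.

Lemma all_lt_low k s : 0 < k -> low k s = sumn s -> all (fun x => x < k) s.
Proof.
move=> k_gt0; elim: s => [|x s IHs] //=; rewrite low_cons; have := low_le_sumn k s.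
by case: ltnP => ? ? ?; [apply: IHs; lia | lia].
Qed.

Lemma mem_leq_sumn x s : x \in s -> x <= sumn s.
Proof.
by elim: s => //= y s IHs; rewrite inE => /predU1P[->|/IHs]; lia.
Qed.

(** * Refinement as the pointwise order of these sums *)

(** A group with sum below [k] has only parts below [k], so its whole sum is also counted in
    [low k la]; the other groups add nothing on the left. *)
Lemma refines_low mu la k : refines_le mu la -> low k mu <= low k la.
Proof.
case=> gs [_ /perm_low <- /perm_low <-].
rewrite /low big_map big_mkcond big_flatten; apply: leq_sum => g _ /=.
case: ifP => // gk; rewrite -/(low k g) low_all_lt //.
by apply/allP => x /mem_leq_sumn xg; apply: leq_ltn_trans gk.
Qed.

(* Taking parts greedily from the largest on, the amount still missing stays
   a multiple of the next part, so the target is hit exactly. *)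
Lemma prefix_sum (la : seq nat) (r : nat) :
  sorted (fun x y => y %| x) la -> 0 \notin la -> head 0 la %| r ->
  r <= sumn la -> exists p, sumn (take p la) = r.
Proof.
elim: la r => [|a la IHla] r /= la_sorted la_gt0 a_dvd r_le.
  by exists 0; move: r_le; rewrite leqn0 => /eqP.
have [->|r_gt0] := posnP r; first by exists 0.
have a_le : a <= r by apply: dvdn_leq.
move: la_gt0; rewrite inE negb_or => /andP[a_neq0 la_gt0].
have head_dvd : head 0 la %| r - a.
  case: la la_sorted r_le {IHla la_gt0} => [|c la] /=.
    (* With an empty tail [head] takes its default value 0, which divides only 0; the bound on [r]
       gives [r = a]. *)
    by move=> _ r_le; have -> : r - a = 0 by lia.
  by move=> /andP[ca _] _; rewrite dvdn_sub // (dvdn_trans ca).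
have [||||p pE] := IHla (r - a) => //.
- exact: path_sorted la_sorted.
- lia.
by exists p.+1; rewrite /= pE subnKC.
Qed.

Lemma geq_trans : transitive geq.
Proof. by move=> y x z yx zy; apply: leq_trans yx. Qed.

(** If all parts left after the drop are below [k], [low k] is their full sum. Otherwise one of them
    is at least [k], hence so are all removed parts, and [low k] loses nothing. *)
Lemma low_drop (la : seq nat) p k :
  sorted geq la -> minn (low k la) (sumn (drop p la)) <= low k (drop p la).
Proof.
move=> la_sorted; have [/low_all_lt ->|] := boolP (all (fun x => x < k) (drop p la)).
  exact: geq_minr.
case/allPn => y y_in; rewrite -leqNgt => k_le.
apply: leq_trans (geq_minl _ _) _.
rewrite -{1}(cat_take_drop p la) low_cat low_all_ge //.
apply/allP => x x_in; apply: leq_trans k_le _.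
move: la_sorted; rewrite -{1}(cat_take_drop p la) (sorted_pairwise geq_trans).
by rewrite pairwise_cat => /and3P[/allrelP take_ge _ _]; apply: take_ge.
Qed.

Lemma power_dvd b x y :
  0 < b -> is_power b x -> is_power b y -> x <= y -> x %| y.
Proof.
move=> b_gt0 /(is_powerP x b_gt0)[i ->] /(is_powerP y b_gt0)[j ->].
have [/dvdn_exp2l -> //|ltji le_ij] := leqP i j.
have /eqP -> // : b ^ i == b ^ j.
by rewrite eqn_leq le_ij leq_pexp2l // ltnW.
Qed.

Lemma sorted_power_dvd b s :
  0 < b -> all (is_power b) s -> sorted geq s -> sorted (fun x y => y %| x) s.
Proof.
move=> b_gt0 s_pow; apply: (sub_in_sorted _ s_pow) => x y xp yp.
exact: power_dvd yp xp.
Qed.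

(** Converse of [refines_low], by induction on [mu]: a prefix of [la] sums exactly to the largest
    part [x] of [mu] and becomes its group. By [low_drop] the hypotheses pass to the remaining
    parts. *)
Lemma low_refines b (mu la : seq nat) :
  1 < b -> sorted geq la -> all (is_power b) mu -> sorted geq mu ->
  all (is_power b) la -> 0 \notin mu -> 0 \notin la -> sumn mu = sumn la ->
  (forall j, low (b ^ j) mu <= low (b ^ j) la) -> refines_le mu la.
Proof.
move=> b_gt1; have b_gt0 := ltnW b_gt1.
elim: mu la => [|x mu IHmu] la la_sorted mu_pow mu_sorted la_pow mu_pos la_pos.
  move=> sum_la _; exists [::]; split=> //=.
  case: la la_pos sum_la {la_sorted la_pow} => //= a la.
  by rewrite inE negb_or => /andP[? _]; lia.
move=> /= sum_eq low_le.
case/andP: mu_pow => x_pow mu_pow.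
move: mu_pos; rewrite inE negb_or => /andP[x_neq0 mu_pos].
have /(is_powerP x b_gt0)[k xE] := x_pow.
(* At the threshold [b ^ k.+1] all of [mu] is counted, so all of [la] must be too. Hence every part
   of [la] divides [x]. *)
have la_lt : all (fun y => y < b ^ k.+1) la.
  apply: all_lt_low; rewrite ?expn_gt0 ?b_gt0 //.
  apply/eqP; rewrite eqn_leq low_le_sumn -sum_eq.
  apply: leq_trans (low_le k.+1); rewrite low_all_lt //=.
  have x_lt : x < b ^ k.+1 by rewrite xE ltn_exp2l.
  rewrite x_lt; move: mu_sorted => /=; rewrite (path_sortedE geq_trans).
  by case/andP=> /allP mu_le _; apply/allP => y /mu_le yx; apply: leq_ltn_trans x_lt.
have la_dvd y : y \in la -> y %| x.
  move=> y_in; have /(is_powerP y b_gt0)[i yE] := allP la_pow y y_in.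
  by have := allP la_lt y y_in; rewrite /= yE xE ltn_exp2l // ltnS => /dvdn_exp2l.
have [||||p pE] := @prefix_sum la x => //.
- exact: sorted_power_dvd la_pow la_sorted.
- case: (la) la_dvd sum_eq => /= [|a la' ad _]; first lia.
  by apply: ad; rewrite mem_head.
- lia.
have sum_drop : sumn mu = sumn (drop p la).
  by have := sumn_cat (take p la) (drop p la); rewrite cat_take_drop; lia.
have [|||||||j|gs [gs_ne gs_la gs_mu]] := IHmu (drop p la) => //.
- exact: drop_sorted.
- exact: path_sorted mu_sorted.
- by apply/allP => y /mem_drop; apply: (allP la_pow).
- by apply: contra la_pos; apply: mem_drop.
- apply: leq_trans (low_drop p _ la_sorted).
  rewrite leq_min -sum_drop low_le_sumn andbT.
  by apply: leq_trans (low_le j); rewrite low_cons leq_addl.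
exists (take p la :: gs); split.
- rewrite inE negb_or gs_ne andbT; apply: contra x_neq0 => /eqP tE.
  by rewrite -pE -tE.
- by rewrite /= -[X in perm_eq _ X](cat_take_drop p la) perm_cat2l.
- by rewrite /= pE perm_cons.
Qed.

(** * Profiles of hyper partitions *)

(** The only power of [b] from [b ^ j] up to but excluding [b ^ j.+1] is [b ^ j] itself. *)
Lemma low_succ b s j : 1 < b -> all (is_power b) s ->
  low (b ^ j.+1) s = low (b ^ j) s + count_mem (b ^ j) s * b ^ j.
Proof.
move=> b_gt1; have b_gt0 := ltnW b_gt1.
elim: s => [|x s IHs] /=; first by rewrite /low !big_nil.
move=> /andP[/(is_powerP x b_gt0)[i ->] /IHs]; rewrite !low_cons => ->.
rewrite !ltn_exp2l // ltnS eqn_exp2l // mulnDl.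
by have [ij|ij|->] := ltngtP i j; rewrite /= ?mul1n ?mul0n; lia.
Qed.

Lemma sumn_sub_low k s : sumn s - low k s = \sum_(x <- s | k <= x) x.
Proof.
rewrite sumnE (bigID (fun x => x < k)) /= addKn.
by apply: eq_bigl => x; rewrite -leqNgt.
Qed.

(* The image of [fun s j => low (b ^ j) s] on the hyper partitions of n. *)
Definition low_profile (b t n : nat) (L : nat -> nat) : Prop :=
  [/\ L 0 = 0, forall j, n <= j -> L j = n,
      forall j, b ^ j %| n - L j, forall j, L j <= L j.+1
    & forall j, L j.+1 <= L j + t * b ^ j].

(** Divisibility constrains each value separately, and the minimum is one of the two values; the
    bounds on consecutive values pass to the minimum by monotonicity. *)
Lemma low_profile_min b t n L L' : low_profile b t n L -> low_profile b t n L' ->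
  low_profile b t n (fun j => minn (L j) (L' j)).
Proof.
case=> L0 Ln Ld Lm Lt [L'0 L'n L'd L'm L't]; split=> [|j nj|j|j|j].
- by rewrite L0 L'0.
- by rewrite Ln // L'n // minnn.
- by case: leqP.
- by move: (Lm j) (L'm j); lia.
- by move: (Lt j) (L't j); lia.
Qed.

Lemma low_profile_max b t n L L' : low_profile b t n L -> low_profile b t n L' ->
  low_profile b t n (fun j => maxn (L j) (L' j)).
Proof.
case=> L0 Ln Ld Lm Lt [L'0 L'n L'd L'm L't]; split=> [|j nj|j|j|j].
- by rewrite L0 L'0.
- by rewrite Ln // L'n // maxnn.
- by case: leqP.
- by move: (Lm j) (L'm j); lia.
- by move: (Lt j) (L't j); lia.
Qed.

Lemma low_profileP b t n s : 1 < b -> is_hyper_partition b t n s ->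
  low_profile b t n (fun j => low (b ^ j) s).
Proof.
move=> b_gt1 /and3P[/and3P[s_sorted s_pos /eqP sE] s_pow s_mult].
have b_gt0 := ltnW b_gt1.
split=> [|j nj|j|j|j].
- apply: low_all_ge; apply/allP => x xs.
  by rewrite expn0 lt0n; apply: contraNneq s_pos => <-.
(* Every part is at most [n <= j < b ^ j]. *)
- rewrite low_all_lt //; apply/allP => x /mem_leq_sumn; rewrite sE => xn.
  by apply: leq_ltn_trans (ltn_expl j b_gt1); apply: leq_trans nj.
(* The difference is the sum of the parts that are at least [b ^ j], and [b ^ j] divides each of
   these. *)
- rewrite -sE sumn_sub_low big_seq_cond; apply: dvdn_sum => x /andP[xs le_x].
  have /(is_powerP x b_gt0)[i xE] := allP s_pow x xs.
  by move: le_x; rewrite xE leq_exp2l // => /dvdn_exp2l.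
- by rewrite low_succ // leq_addr.
- rewrite low_succ // leq_add2l leq_mul2r.
  have [/(allP s_mult) ->|/count_memPn ->] := boolP (b ^ j \in s); last by rewrite orbT.
  by rewrite orbT.
Qed.

(** The increments of [L] dictate the multiplicities of the powers of [b], and telescoping recovers
    [L]. *)
Lemma low_profile_realize b t n L : 1 < b -> low_profile b t n L ->
  exists2 s, is_hyper_partition b t n s & forall j, low (b ^ j) s = L j.
Proof.
move=> b_gt1 [L0 Ln Ld Lm Lt]; have b_gt0 := ltnW b_gt1.
have mult_dvd j : b ^ j %| L j.+1 - L j.
  have L_le i : L i <= n.
    have L_homo := homo_leq leqnn leq_trans Lm.
    by rewrite -(Ln (maxn i n)) ?leq_maxr // L_homo // leq_maxl.
  (* Both terms are multiples of [b ^ j]; the bound by [n] keeps the truncated subtractions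
     exact. *)
  have -> : L j.+1 - L j = (n - L j) - (n - L j.+1).
    by move: (Lm j) (L_le j) (L_le j.+1); lia.
  by rewrite dvdn_sub // (dvdn_trans (dvdn_exp2l b (leqnSn j))).
(* Exponents below [n] suffice, since [L] is constant from [n] on. *)
pose parts := flatten [seq nseq ((L j.+1 - L j) %/ b ^ j) (b ^ j) | j <- iota 0 n].
have partsP x : x \in parts -> exists2 j, j < n & x = b ^ j.
  case/flatten_mapP => j; rewrite mem_iota => /andP[_ jn].
  by rewrite mem_nseq => /andP[_ /eqP ->]; exists j.
have parts_pow : all (is_power b) parts.
  by apply/allP => x /partsP[j _ ->]; apply/is_powerP => //; exists j.
have low_parts j : low (b ^ j) parts = L j.
  have -> : low (b ^ j) parts = \sum_(0 <= i < n | i < j) (L i.+1 - L i).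
    rewrite /low big_flatten big_map /index_iota subn0 [RHS]big_mkcond.
    apply: eq_bigr => i _; rewrite big_nseq_cond ltn_exp2l //.
    by case: ifP => // _; rewrite iter_addn_0 mulnC divnK.
  have [le_jn|lt_nj] := leqP j n.
    transitivity (\sum_(0 <= i < j) (L i.+1 - L i)).
      by rewrite [RHS](big_nat_widen 0 j n).
    by rewrite telescope_sumn ?L0 ?subn0 //; apply: homo_leq leq_trans Lm.
  (* For [j > n] the sum telescopes to [L n], which equals [L j]. *)
  rewrite big_nat_cond (eq_bigl (fun i => (0 <= i < n) && true)); last first.
    by move=> i; lia.
  rewrite -big_nat_cond telescope_sumn ?L0 ?subn0; last exact: homo_leq leq_trans Lm.
  by rewrite !Ln // ltnW.
have sort_parts : perm_eq (sort geq parts) parts by rewrite perm_sort.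
exists (sort geq parts); last by move=> j; rewrite (perm_low _ sort_parts).
apply/and3P; split.
- apply/and3P; split.
  + by apply: sort_sorted => x y; apply: leq_total.
  + rewrite mem_sort; apply/negP => /partsP[j _] /esym/eqP.
    by rewrite expn_eq0; lia.
  + rewrite (perm_sumn sort_parts) -(low_all_lt (k := b ^ n)) ?low_parts ?Ln //.
    by apply/allP => x /partsP[j jn ->]; rewrite ltn_exp2l.
- by rewrite all_sort.
- apply/allP => x; rewrite mem_sort => /partsP[j _ ->].
  (* Multiplied by [b ^ j], the multiplicity becomes the increment of [L] at [j], which is at most
     [t * b ^ j]. *)
  rewrite (permP sort_parts) -(leq_pmul2r (_ : 0 < b ^ j)) ?expn_gt0 ?b_gt0 //.
  by have := low_succ j b_gt1 parts_pow; rewrite !low_parts; move: (Lt j); lia.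
Qed.

Lemma refines_le_refl s : refines_le s s.
Proof.
exists [seq [:: x] | x <- s]; split.
- by apply/mapP => -[].
- by rewrite flatten_seq1.
- by rewrite -map_comp (eq_map (g := id)) ?map_id // => x /=; rewrite addn0.
Qed.

(** By [low_succ] the profile determines the multiplicity of each power of [b], and a sorted
    sequence is determined by its multiplicities. *)
Lemma low_inj b t n s s' : 1 < b ->
  is_hyper_partition b t n s -> is_hyper_partition b t n s' ->
  (forall j, low (b ^ j) s = low (b ^ j) s') -> s = s'.
Proof.
move=> b_gt1 /and3P[/and3P[s_sorted _ _] s_pow _].
move=> /and3P[/and3P[s'_sorted _ _] s'_pow _] lowE; have b_gt0 := ltnW b_gt1.
apply: sorted_eq s_sorted s'_sorted _.
- exact: geq_trans.
- by move=> x y /=; lia.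
apply/allP => x; rewrite mem_cat => x_in; apply/eqP.
have /(is_powerP x b_gt0)[j ->] : is_power b x.
  by case/orP: x_in; [apply: (allP s_pow) | apply: (allP s'_pow)].
have := low_succ j b_gt1 s_pow; rewrite !lowE low_succ // => /addnI /eqP.
by rewrite eqn_pmul2r ?expn_gt0 ?b_gt0 // => /eqP.
Qed.

(** * The lattice structure, for [b = 1] and for [b > 1] *)

Lemma hyper_partition_1 t n s : is_hyper_partition 1 t n s -> s = nseq n 1.
Proof.
move=> /and3P[/and3P[_ _ /eqP <-] s_pow _].
elim: s s_pow => //= x s IHs /andP[/(is_powerP x (ltnSn 0))[j ->] /IHs ->].
by rewrite exp1n sumn_nseq mul1n.
Qed.

Theorem theorem3p10 (b t n : nat) (b_gt0 : 0 < b) (t_gt0 : 0 < t)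
    (n_gt0 : 0 < n) (le_bt : b <= t) :
  is_distr_lattice (@hyper_le b t n).
Proof.
have [b_le1|b_gt1] := leqP b 1.
  have b1 : b = 1 by lia.
  subst b; have all_eq (x y : hyper_partition 1 t n) : x = y.
    by apply: val_inj; rewrite (hyper_partition_1 (valP x)) (hyper_partition_1 (valP y)).
  (* With at most one element, the map into functions on the empty type is an embedding. *)
  apply: (@distr_lattice_of_embedding _ 'I_0 _ (fun _ _ => 0)) => //.
  move=> x y; split=> // _; rewrite (all_eq x y).
  exact: refines_le_refl.
(* Cutting the profile at [n] makes the index type finite; from [n] on all profiles have the value
   [n]. *)
pose f (x : hyper_partition b t n) (j : 'I_n) := low (b ^ j) (val x).
have profile x := low_profileP b_gt1 (valP (x : hyper_partition b t n)).
have low_n x j : n <= j -> low (b ^ j) (val (x : hyper_partition b t n)) = n.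
  by case: (profile x) => _ + _ _ _; apply.
apply: (@distr_lattice_of_embedding _ _ _ f).
- move=> x y; split=> [xy i|le_xy]; first exact: refines_low.
  have /and3P[/and3P[x_sorted x_pos /eqP xE] x_pow _] := valP x.
  have /and3P[/and3P[y_sorted y_pos /eqP yE] y_pow _] := valP y.
  apply: (low_refines b_gt1) => // [|j]; first by rewrite xE yE.
  have [jn|nj] := ltnP j n; first exact: (le_xy (Ordinal jn)).
  by rewrite !low_n.
- move=> x y eq_xy; apply/val_inj/(low_inj b_gt1 (valP x) (valP y)) => j.
  have [jn|nj] := ltnP j n; first exact: (eq_xy (Ordinal jn)).
  by rewrite !low_n.
- move=> x y.
  have [s s_hyper sE] :=
    low_profile_realize b_gt1 (low_profile_min (profile x) (profile y)).
  by exists (Sub s s_hyper) => i; rewrite /f SubK sE.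
- move=> x y.
  have [s s_hyper sE] :=
    low_profile_realize b_gt1 (low_profile_max (profile x) (profile y)).
  by exists (Sub s s_hyper) => i; rewrite /f SubK sE.
Qed.
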